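(* Let $n\ge 1$, let $\|\cdot\|$ be a norm on $\mathbb{R}^n$ and let $R>0$. If $C\subseteq\mathbb{R}^n$ is nonempty, compact and strongly convex with respect to $R$, then $$F_{C^{\rho_R}}^{\|\cdot\|}(x)=\max\{\|x-y\| : y\in\mathbb{R}^n,\ F_C^{\|\cdot\|}(y)\le R\}\qquad\forall x\in\mathbb{R}^n.$$
   Context: A set $C\subseteq\mathbb{R}^n$ is strongly convex with respect to $R>0$ if it is an intersection of a (possibly empty) collection of closed balls $B(c,R)=\{x:\|x-c\|\le R\}$ of radius $R$ (the empty intersection being $\mathbb{R}^n$). The $\rho_R$-polar of $C$ is $C^{\rho_R}:=\{y\in\mathbb{R}^n:\|x-y\|\le R\ \ \forall x\in C\}$. For a nonempty compact convex set $D\subseteq\mathbb{R}^n$, the farthest distance function $F_D^{\|\cdot\|}:\mathbb{R}^n\to\mathbb{R}$ is $F_D^{\|\cdot\|}(x):=\max_{d\in D}\|x-d\|$. *)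

(* Defs.v *)
From mathcomp Require Import all_boot all_order all_algebra.
From mathcomp Require Import all_classical all_reals all_analysis.

Set Implicit Arguments.
Unset Strict Implicit.
Unset Printing Implicit Defensive.

Import Order.TTheory GRing.Theory Num.Theory.
Import numFieldNormedType.Exports.

Local Open Scope classical_set_scope.
Local Open Scope ring_scope.

(* R^n is 'rV[R]_n.  The norm under study is a function N, unrelated to the
   canonical (sup) norm of 'rV[R]_n, which only provides the usual topology of
   R^n, used in [compact]. *)

Record is_norm (R : realType) (n : nat) (N : 'rV[R]_n -> R) : Prop := IsNorm {
  norm_triangle : forall x y, N (x + y) <= N x + N y;
  norm_homogeneous : forall (a : R) x, N (a *: x) = `|a| * N x;
  norm_definite : forall x, N x = 0 -> x = 0 }.

Definition cball (R : realType) (n : nat) (N : 'rV[R]_n -> R)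
    (c : 'rV[R]_n) (r : R) : set 'rV[R]_n :=
  [set x | N (x - c) <= r].

(* A collection of balls of radius r is given by the set of its centers;
   the intersection over set0 is setT. *)
Definition strongly_convex (R : realType) (n : nat) (N : 'rV[R]_n -> R)
    (r : R) (C : set 'rV[R]_n) : Prop :=
  exists B : set 'rV[R]_n, C = \bigcap_(c in B) cball N c r.

Definition polar (R : realType) (n : nat) (N : 'rV[R]_n -> R)
    (r : R) (C : set 'rV[R]_n) : set 'rV[R]_n :=
  [set y | forall x, C x -> N (x - y) <= r].

Definition is_max (R : realType) (A : set R) (m : R) : Prop :=
  A m /\ ubound A m.

(* The default value 0 is used only when there is no maximum, hence never when
   D is nonempty and compact. *)
Definition farthest_dist (R : realType) (n : nat) (N : 'rV[R]_n -> R)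
    (D : set 'rV[R]_n) (x : 'rV[R]_n) : R :=
  xget 0 [set m | is_max [set N (x - d) | d in D] m].

(* Main.v *)
(* The sublevel set {y | F_C(y) <= r} is the polar of C, because the maximum
   defining F_C(y) is attained.  The polar is an intersection of closed balls,
   hence compact and convex; it is nonempty because it contains the center of
   every ball of radius r containing C, and C, being bounded, is not the empty
   intersection of balls. *)
Require Import Defs.
From mathcomp Require Import all_boot all_order all_algebra.
From mathcomp Require Import all_classical all_reals all_analysis.

Set Implicit Arguments.
Unset Strict Implicit.
Unset Printing Implicit Defensive.

Import Order.TTheory GRing.Theory Num.Theory.
Import numFieldNormedType.Exports.

Local Open Scope classical_set_scope.
Local Open Scope ring_scope.

Lemma normr_coord_le (R : realType) (n : nat) (x : 'rV[R]_n) (i : 'I_n) :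
  `|x ord0 i| <= `|x|.
Proof.
rewrite -[leRHS]/(mx_norm x) mx_normrE.
exact: (le_bigmax _ (fun ij => `|x ij.1 ij.2|) (ord0, i)).
Qed.

(** [bounded_set] asks that every m above some threshold be a bound; a single bound M serves as that
    threshold. *)
Lemma bounded_setW (R : realType) (V : normedModType R) (A : set V) (M : R) :
  (forall x, A x -> `|x| <= M) -> bounded_set A.
Proof.
move=> AM; exists M; split=> [|m Mm x Ax]; first exact: num_real.
exact: le_trans (AM _ Ax) (ltW Mm).
Qed.

Section IsNorm.
Variables (R : realType) (n : nat) (N : 'rV[R]_n -> R).
Hypothesis hN : is_norm N.

Lemma is_norm0 : N 0 = 0.
Proof. by rewrite -(scale0r 0) (norm_homogeneous hN) normr0 mul0r. Qed.

Lemma is_normN x : N (- x) = N x.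
Proof. by rewrite -scaleN1r (norm_homogeneous hN) normrN1 mul1r. Qed.

Lemma is_norm_distC x y : N (x - y) = N (y - x).
Proof. by rewrite -is_normN opprB. Qed.

(** Nonnegativity is not an axiom of [is_norm]; it follows from 0 = N (x - x) <= 2 N x. *)
Lemma is_norm_ge0 x : 0 <= N x.
Proof.
have := norm_triangle hN x (- x).
by rewrite subrr is_norm0 is_normN -mulr2n pmulrn_lge0.
Qed.

Lemma is_norm_sum (I : Type) (s : seq I) (f : I -> 'rV[R]_n) :
  N (\sum_(i <- s) f i) <= \sum_(i <- s) N (f i).
Proof.
elim/big_ind2 : _ => [|x a y b xa yb|//]; first by rewrite is_norm0.
by rewrite (le_trans (norm_triangle hN _ _)) ?lerD.
Qed.

(** Expand x in the standard basis: each coordinate is at most the sup norm of x, so K can be the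
    sum of the N-values of the basis vectors. *)
Lemma is_norm_upper : exists K : R, forall x, N x <= K * `|x|.
Proof.
exists (\sum_i N (delta_mx 0 i)) => x.
rewrite {1}[x]row_sum_delta (le_trans (is_norm_sum _ _))// mulr_suml.
apply: ler_sum => i _; rewrite (norm_homogeneous hN) mulrC.
by rewrite ler_wpM2l ?is_norm_ge0 ?normr_coord_le.
Qed.

Lemma is_norm_dist x y : `|N x - N y| <= N (x - y).
Proof.
rewrite ler_norml lerBrDr lerBlDr addrC lerBlDr; apply/andP; split.
  rewrite addrC is_norm_distC; have := norm_triangle hN (y - x) x.
  by rewrite subrK.
by have := norm_triangle hN (x - y) y; rewrite subrK.
Qed.

(** By the reverse triangle inequality and [is_norm_upper], N is Lipschitz for the sup norm. *)
Lemma is_norm_continuous : continuous N.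
Proof.
have [K NK] := is_norm_upper.
(* The Lipschitz constant is enlarged to a positive number so that e can be divided by it. *)
have K1 : 0 < `|K| + 1 by rewrite ltr_wpDl.
move=> x; apply/(@cvgrPdist_lt _ _ _ (nbhs x) (nbhs_filter x)) => e e0.
apply/(@nbhs_normP _ 'rV[R]_n x).
exists (e / (`|K| + 1)) => /= [|y xy]; first by rewrite divr_gt0.
rewrite (le_lt_trans (is_norm_dist _ _))// (le_lt_trans (NK _))//.
rewrite (@le_lt_trans _ _ ((`|K| + 1) * `|x - y|))//.
  by rewrite ler_wpM2r// (le_trans (ler_norm K))// lerDl.
by rewrite mulrC -ltr_pdivlMr.
Qed.

Lemma is_norm_subl_continuous x : continuous (fun y : 'rV[R]_n => N (x - y)).
Proof.
move=> y; apply: (@continuous_comp 'rV[R]_n 'rV[R]_n R^o (fun z => x - z) N y).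
  by apply: continuousB; [exact: cst_continuous|exact: cvg_id].
exact: is_norm_continuous.
Qed.

(** N attains a minimum on the compact sup-norm unit sphere S; it is positive by definiteness, and
    homogeneity carries the bound to all x. With [is_norm_upper], this makes N equivalent to the sup
    norm. *)
Lemma is_norm_lower : exists2 k : R, 0 < k & forall x, k * `|x| <= N x.
Proof.
have homog x : x != 0 -> N x = `|x| * N (`|x|^-1 *: x).
  move=> x0; rewrite (norm_homogeneous hN) normfV normr_id mulrA.
  by rewrite divff ?mul1r ?normr_eq0.
pose S := [set x : 'rV[R]_n | `|x| = 1].
have unitS x : x != 0 -> S (`|x|^-1 *: x).
  by move=> x0; rewrite /S/= normrZ normfV normr_id mulVf ?normr_eq0.
(* If S is empty (dimension 0), there is no nonzero vector and any positive constant works. *)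
have [S0|/set0P Sn0] := eqVneq S set0.
  exists 1 => // x; have [->|x0] := eqVneq x 0.
    by rewrite normr0 mulr0 is_norm_ge0.
  by have := unitS _ x0; rewrite S0.
have cS : compact S.
  apply: bounded_closed_compact.
    by apply: (@bounded_setW _ _ _ 1) => x ->.
  apply: (@preimage_closed _ _ (fun x : 'rV[R]_n => `|x|) [set x | x = 1]).
    by move=> x _; exact: norm_continuous.
  exact: closed_eq.
have [c] := compact_EVT_min Sn0 cS (continuous_subspaceT is_norm_continuous).
rewrite inE => Sc minc; exists (N c).
  rewrite lt_def is_norm_ge0 andbT; apply/eqP => /(norm_definite hN) c0.
  by move: Sc; rewrite /S/= c0 normr0 => /esym/eqP; rewrite oner_eq0.
move=> x; have [->|x0] := eqVneq x 0; first by rewrite normr0 mulr0 is_norm_ge0.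
by rewrite (homog _ x0) mulrC ler_wpM2l// minc// inE; exact: unitS.
Qed.

Lemma polar_bigcap r C : polar N r C = \bigcap_(x in C) [set y | N (x - y) <= r].
Proof. by []. Qed.

(** One point c of C gives N y <= r + N c on the polar, which [is_norm_lower] turns into a sup-norm
    bound. Closedness comes from continuity of each y |-> N (x - y). *)
Lemma polar_compact r C : C !=set0 -> compact (polar N r C).
Proof.
move=> [c Cc]; apply: bounded_closed_compact.
  have [k k0 kN] := is_norm_lower.
  apply: (@bounded_setW _ _ _ ((r + N c) / k)) => y /(_ _ Cc) Ncy.
  rewrite ler_pdivlMr// mulrC (le_trans (kN _))// -(subrK c y).
  by rewrite (le_trans (norm_triangle hN _ _))// lerD2r is_norm_distC.
rewrite polar_bigcap; apply: closed_bigI => x _.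
apply: (@preimage_closed _ _ (fun y : 'rV[R]_n => N (x - y)) [set t | t <= r]).
  by move=> y _; exact: is_norm_subl_continuous.
exact: closed_le.
Qed.

Lemma polar_convex r C : convex_set (polar N r C).
Proof.
apply/convex_setW => y z; rewrite !inE => Py Pz k k0 k1; rewrite inE => x Cx.
(* The weights k and 1 - k sum to 1, so x splits along the convex combination of y and z. *)
rewrite [X in N X](_ : _ = k%:num *: (x - y) + (1 - k%:num) *: (x - z)).
  rewrite (le_trans (norm_triangle hN _ _))// !(norm_homogeneous hN).
  rewrite !ger0_norm ?subr_ge0 ?(ltW k0) ?(ltW k1)//.
  have -> : r = k%:num * r + (1 - k%:num) * r by rewrite -mulrDl subrKC mul1r.
  by apply: lerD; rewrite ler_wpM2l ?subr_ge0 ?(ltW k0) ?(ltW k1) ?(Py, Pz).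
by rewrite !scalerBr addrACA -opprD -scalerDl subrKC scale1r.
Qed.

(** The extreme value theorem provides a maximum, so [xget] never returns its default 0. *)
Lemma farthest_distP (D : set 'rV[R]_n) x : D !=set0 -> compact D ->
  is_max [set N (x - d) | d in D] (farthest_dist N D x).
Proof.
move=> D0 cD.
have [d] := compact_EVT_max D0 cD
  (continuous_subspaceT (@is_norm_subl_continuous x)).
rewrite inE => Dd maxd; apply: (@xgetPex _ 0 [set m | is_max _ m]).
exists (N (x - d)); split; first by exists d.
by move=> _ [e De <-]; apply: maxd; rewrite inE.
Qed.

Lemma farthest_dist_le_polar r C : C !=set0 -> compact C ->
  [set y | farthest_dist N C y <= r] = polar N r C.
Proof.
move=> C0 cC; apply/seteqP; split => y /=.
  move=> Fr x Cx; rewrite is_norm_distC (le_trans _ Fr)//.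
  by have [_] := farthest_distP y C0 cC; apply; exists x.
have [[x Cx <-] _] := farthest_distP y C0 cC.
by rewrite is_norm_distC; apply.
Qed.

End IsNorm.

Lemma setT_rV_not_compact (R : realType) (n : nat) :
  (0 < n)%N -> ~ compact [set: 'rV[R]_n].
Proof.
move=> n0 /compact_bounded[M [_ bM]].
(* The constant vector with entries [|M| + 2] exceeds the bound M + 1; a coordinate to read it off
   exists because 0 < n. *)
have := bM (M + 1); rewrite ltrDl ltr01 => /(_ isT (const_mx (`|M| + 2)) I)/=.
apply/negP; rewrite -ltNge.
rewrite (lt_le_trans _ (normr_coord_le _ (Ordinal n0)))// mxE.
by rewrite (lt_le_trans _ (ler_norm _))// ler_ltD ?ler_norm ?ltr1n.
Qed.

Lemma polar_nonempty (R : realType) (n : nat) (N : 'rV[R]_n -> R) (r : R)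
    (C : set 'rV[R]_n) :
  (0 < n)%N -> compact C -> strongly_convex N r C -> polar N r C !=set0.
Proof.
move=> n0 cC [B CB]; have [B0|/set0P[c Bc]] := eqVneq B set0.
  by move: cC; rewrite CB B0 bigcap_set0 => /(setT_rV_not_compact n0).
by exists c => x; rewrite CB; apply.
Qed.

Theorem proposition19 (R : realType) (n : nat) (hn : (1 <= n)%N)
    (N : 'rV[R]_n -> R) (hN : is_norm N) (r : R) (hr : 0 < r)
    (C : set 'rV[R]_n) (hC0 : C !=set0) (hCc : compact C)
    (hCs : strongly_convex N r C) :
  [/\ polar N r C !=set0, compact (polar N r C) & convex_set (polar N r C)] /\
  forall x : 'rV[R]_n,
    is_max [set N (x - y) | y in [set y | farthest_dist N C y <= r]]
           (farthest_dist N (polar N r C) x).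
Proof.
have P0 := polar_nonempty hn hCc hCs.
have cP := @polar_compact _ _ _ hN r _ hC0.
split; first by split=> //; exact: polar_convex.
(* Once the sublevel set is rewritten as the polar, the claim is that the farthest distance to the
   polar is an attained maximum. *)
by move=> x; rewrite farthest_dist_le_polar//; exact: farthest_distP.
Qed.
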